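(* Let $n\ge 3$, let $q_1,\dots,q_n\in\mathbb{H}$ with $q_1\neq 0$, put $q_0=0$, and let $v_j=q_jq_n-q_{j-1}$ for $j=1,\dots,n$. Let $$f_{r_1}(z)=z^{n+1}-z^{n-1}v_n-z^{n-2}v_{n-1}-\cdots-zv_2-v_1.$$ Then every zero $z\in\mathbb{H}$ of $f_{r_1}$ satisfies $$|z|\le\left(1+2\sum_{j=1}^{n}|v_j|^2\right)^{1/4}.$$
   Context: $\mathbb{H}$ is the real quaternion division algebra, and $|a+bi+cj+dk|=\sqrt{a^2+b^2+c^2+d^2}$. The quaternions $q_1,\dots,q_n$ are the coefficients of the monic polynomial $f_r(z)=z^n+z^{n-1}q_n+\cdots+zq_2+q_1$, from which $f_{r_1}$ is constructed. Polynomials have their coefficients written on the right of the powers of $z$; a zero of $f_{r_1}$ is a quaternion $z$ with $z^{n+1}-z^{n-1}v_n-\cdots-zv_2-v_1=0$ (direct evaluation in $\mathbb{H}$). *)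

(* Defs.v *)
From HB Require Import structures.
From mathcomp Require Import all_boot all_order all_algebra.
From mathcomp Require Import ring reals exp.

Set Implicit Arguments.
Unset Strict Implicit.
Unset Printing Implicit Defensive.

Import Order.TTheory GRing.Theory Num.Theory.
Local Open Scope ring_scope.

(* [Quat a b c d] stands for a + b i + c j + d k. *)
Record quat (R : Type) := Quat { qre : R; qi : R; qj : R; qk : R }.

Section QuatRing.
Variable R : realType.

Definition quat_to_tuple (x : quat R) := (qre x, qi x, qj x, qk x).
Definition quat_of_tuple (t : R * R * R * R) :=
  let: (a, b, c, d) := t in Quat a b c d.

Lemma quat_to_tupleK : cancel quat_to_tuple quat_of_tuple.
Proof. by case. Qed.

HB.instance Definition _ := Choice.copy (quat R) (can_type quat_to_tupleK).

Definition addq (x y : quat R) :=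
  Quat (qre x + qre y) (qi x + qi y) (qj x + qj y) (qk x + qk y).

Definition oppq (x : quat R) := Quat (- qre x) (- qi x) (- qj x) (- qk x).

(* Hamilton's relations i^2 = j^2 = k^2 = ijk = -1, extended bilinearly. *)
Definition mulq (x y : quat R) :=
  Quat (qre x * qre y - qi x * qi y - qj x * qj y - qk x * qk y)
       (qre x * qi y + qi x * qre y + qj x * qk y - qk x * qj y)
       (qre x * qj y - qi x * qk y + qj x * qre y + qk x * qi y)
       (qre x * qk y + qi x * qj y - qj x * qi y + qk x * qre y).

Lemma addqA : associative addq.
Proof. by move=> x y z; rewrite /addq /= !addrA. Qed.

Lemma addqC : commutative addq.
Proof. by move=> x y; rewrite /addq; congr Quat; rewrite addrC. Qed.

Lemma add0q : left_id (Quat 0 0 0 0) addq.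
Proof. by case=> a b c d; rewrite /addq /= !add0r. Qed.

Lemma addNq : left_inverse (Quat 0 0 0 0) oppq addq.
Proof. by case=> a b c d; rewrite /addq /oppq /= !addNr. Qed.

HB.instance Definition _ :=
  GRing.isZmodule.Build (quat R) addqA addqC add0q addNq.

Lemma mulqA : associative mulq.
Proof.
by case=> a b c d [a' b' c' d'] [x y z t]; rewrite /mulq /=; congr Quat; ring.
Qed.

Lemma mul1q : left_id (Quat 1 0 0 0) mulq.
Proof. by case=> a b c d; rewrite /mulq /=; congr Quat; ring. Qed.

Lemma mulq1 : right_id (Quat 1 0 0 0) mulq.
Proof. by case=> a b c d; rewrite /mulq /=; congr Quat; ring. Qed.

Lemma mulqDl : left_distributive mulq addq.
Proof.
case=> a b c d [a' b' c' d'] [x y z t].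
by rewrite /mulq /addq /=; congr Quat; ring.
Qed.

Lemma mulqDr : right_distributive mulq addq.
Proof.
case=> a b c d [a' b' c' d'] [x y z t].
by rewrite /mulq /addq /=; congr Quat; ring.
Qed.

Lemma oneq_neq0 : Quat 1 0 0 0 != 0 :> quat R.
Proof. by apply/eqP=> -[/eqP]; rewrite oner_eq0. Qed.

HB.instance Definition _ := GRing.Zmodule_isNzRing.Build (quat R)
  mulqA mul1q mulq1 mulqDl mulqDr oneq_neq0.

Definition qnorm (x : quat R) : R :=
  Num.sqrt (qre x ^+ 2 + qi x ^+ 2 + qj x ^+ 2 + qk x ^+ 2).

Definition vcoef (n : nat) (q : nat -> quat R) (j : nat) : quat R :=
  q j * q n - q j.-1.

(* The coefficients act on the right of the powers of [z], so this is not the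
   library's [horner], which puts them on the left. *)
Definition fr1 (n : nat) (q : nat -> quat R) (z : quat R) : quat R :=
  z ^+ n.+1 - \sum_(1 <= j < n.+1) z ^+ j.-1 * vcoef n q j.

End QuatRing.

(* Main.v *)
Require Import Defs.
From mathcomp Require Import all_boot all_order all_algebra.
From mathcomp Require Import ring lra reals exp.

Import Order.TTheory GRing.Theory Num.Theory.
Local Open Scope ring_scope.

(** Write [t] for the norm of the zero [z] and [S] for the sum of the
    [qnorm (vcoef n q j) ^+ 2].  The equation expresses [z ^+ n.+1] as the sum
    of the [z ^+ j.-1 * vcoef n q j].  As the quaternion norm is multiplicative
    ([qnormM]) and subadditive ([qnormD]), Cauchy-Schwarz
    ([sum_cauchy_schwarz]) turns this into an inequality in [x = t ^+ 2],
<<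
      x ^ (n+1) <= S * (1 + x + ... + x ^ (n-1)).
>>
    If [1 < x], summing the geometric series gives
    [x ^ (n+1) * (x - 1) <= S * (x ^ n - 1) <= S * x ^ n], so
    [x * (x - 1) <= S].  In particular [x - 1 <= S], and adding the two bounds
    gives [x ^ 2 <= 1 + 2 * S] ([geometric_root_bound]), which is the claim
    because [t ^ 4 = x ^ 2].  If [x <= 1], the claim is immediate. *)

Section QuaternionNorm.
Variable R : realType.
Implicit Types x y : quat R.

Definition conjq x : quat R := Quat (qre x) (- qi x) (- qj x) (- qk x).

Lemma qnorm_ge0 x : 0 <= qnorm x.
Proof. exact: sqrtr_ge0. Qed.

Lemma sqr_qnorm x :
  qnorm x ^+ 2 = qre x ^+ 2 + qi x ^+ 2 + qj x ^+ 2 + qk x ^+ 2.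
Proof. by rewrite sqr_sqrtr // !addr_ge0 ?sqr_ge0. Qed.

Lemma qnorm0 : qnorm (0 : quat R) = 0.
Proof. by rewrite /qnorm /= expr0n /= !addr0 sqrtr0. Qed.

Lemma qnorm1 : qnorm (1 : quat R) = 1.
Proof. by rewrite /qnorm /= expr0n expr1n /= !addr0 sqrtr1. Qed.

(** Euler's four-square identity. *)
Lemma qnormM x y : qnorm (x * y) = qnorm x * qnorm y.
Proof.
rewrite /qnorm -sqrtrM ?addr_ge0 ?sqr_ge0 //; congr Num.sqrt.
case: x => a b c d; case: y => a' b' c' d' /=; ring.
Qed.

Lemma qnormX x m : qnorm (x ^+ m) = qnorm x ^+ m.
Proof.
by elim: m => [|m IH]; rewrite ?expr0 ?qnorm1 // !exprS qnormM IH.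
Qed.

Lemma qnorm_conj x : qnorm (conjq x) = qnorm x.
Proof. by rewrite /qnorm /= !sqrrN. Qed.

Lemma qre_le_qnorm x : qre x <= qnorm x.
Proof.
apply: le_trans (ler_norm _) _; rewrite -sqrtr_sqr ler_wsqrtr //.
by rewrite -!addrA lerDl !addr_ge0 ?sqr_ge0.
Qed.

(** The Euclidean inner product of [x] and [y] is the real part of
    [x * conjq y], so it is at most [qnorm x * qnorm y] by multiplicativity;
    expanding the square of [qnorm (x + y)] then gives the triangle
    inequality. *)
Lemma qnormD x y : qnorm (x + y) <= qnorm x + qnorm y.
Proof.
rewrite -ler_sqr ?nnegrE ?addr_ge0 ?qnorm_ge0 // sqrrD.
have := qre_le_qnorm (x * conjq y); rewrite qnormM qnorm_conj !sqr_qnorm.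
by case: x => a b c d; case: y => a' b' c' d' /= h; lra.
Qed.

Lemma qnorm_sum (I : Type) (r : seq I) (F : I -> quat R) :
  qnorm (\sum_(i <- r) F i) <= \sum_(i <- r) qnorm (F i).
Proof.
apply: (big_ind2 (fun u s => qnorm u <= s)) => [|x a y b xa yb|//].
  by rewrite qnorm0.
exact: le_trans (qnormD x y) (lerD xa yb).
Qed.

End QuaternionNorm.

(** Lagrange's argument: summing the squares [(a i * b j - a j * b i) ^+ 2]
    over all pairs gives twice the difference of the two sides. *)
Lemma sum_cauchy_schwarz (R : realDomainType) (I : Type) (r : seq I)
    (a b : I -> R) :
  (\sum_(i <- r) a i * b i) ^+ 2
    <= (\sum_(i <- r) a i ^+ 2) * (\sum_(i <- r) b i ^+ 2).
Proof.
have sumM (f g : I -> R) : (\sum_(i <- r) f i) * (\sum_(j <- r) g j)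
    = \sum_(i <- r) \sum_(j <- r) f i * g j by exact: big_distrlr.
have : 0 <= \sum_(i <- r) \sum_(j <- r) (a i * b j - a j * b i) ^+ 2.
  by apply: sumr_ge0 => i _; apply: sumr_ge0 => j _; exact: sqr_ge0.
have -> : \sum_(i <- r) \sum_(j <- r) (a i * b j - a j * b i) ^+ 2
    = \sum_(i <- r) \sum_(j <- r) a i ^+ 2 * b j ^+ 2
      + \sum_(i <- r) \sum_(j <- r) b i ^+ 2 * a j ^+ 2
      - (\sum_(i <- r) \sum_(j <- r) (a i * b i) * (a j * b j)) *+ 2.
  rewrite -sumrMnl -big_split -sumrB; apply: eq_bigr => i _ /=.
  rewrite -sumrMnl -big_split -sumrB; apply: eq_bigr => j _ /=; ring.
by rewrite -!sumM; lra.
Qed.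

(** For [1 < x] the hypothesis times [x - 1] telescopes to
    [x * (x - 1) <= S]; this bounds both [x ^+ 2 - x] and [x - 1] by [S]. *)
Lemma geometric_root_bound (R : realFieldType) (n : nat) (x S : R) :
  0 <= x -> 0 <= S -> x ^+ n.+1 <= S * \sum_(i < n) x ^+ i ->
  x ^+ 2 <= 1 + 2 * S.
Proof.
move=> x0 S0 xS; have [x1|x1] := leP x 1; first by nra.
have xn0 : 0 < x ^+ n by rewrite exprn_gt0 // (lt_trans ltr01).
have xxS : x * (x - 1) <= S.
  rewrite -(ler_pM2r xn0).
  have x10 : 0 < x - 1 by rewrite subr_gt0.
  move: xS; rewrite -(ler_pM2l x10 (x ^+ n.+1)).
  by rewrite [leRHS]mulrCA -subrX1 exprS; nra.
nra.
Qed.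

Lemma le_powR_fourth_root (R : realType) (t c : R) :
  0 <= t -> t ^+ 4 <= c -> t <= c `^ (1 / 4).
Proof.
move=> t0 tc; have t40 : 0 <= t ^+ 4 by rewrite exprn_ge0.
have <- : (t ^+ 4) `^ (1 / 4) = t.
  by rewrite -powR_mulrn // -powRrM mul1r mulfV ?pnatr_eq0 // powRr1.
by rewrite ge0_ler_powR ?nnegrE ?divr_ge0 // (le_trans t40).
Qed.

Theorem theorem3 (R : realType) (n : nat) (hn : (3 <= n)%N)
    (q : nat -> quat R) (hq0 : q 0%N = 0) (hq1 : q 1%N <> 0)
    (z : quat R) (hz : fr1 n q z = 0) :
  qnorm z <= (1 + 2 * \sum_(1 <= j < n.+1) qnorm (vcoef n q j) ^+ 2) `^ (1 / 4).
Proof.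
apply: le_powR_fourth_root; first exact: qnorm_ge0.
rewrite (exprM _ 2 2); apply: (@geometric_root_bound _ n).
- exact: sqr_ge0.
- by apply: sumr_ge0 => j _; exact: sqr_ge0.
rewrite -exprM mulnC exprM -(qnormX _ z n.+1).
have -> : z ^+ n.+1 = \sum_(1 <= j < n.+1) z ^+ j.-1 * vcoef n q j.
  exact/subr0_eq.
have -> : \sum_(i < n) (qnorm z ^+ 2) ^+ i
    = \sum_(1 <= j < n.+1) (qnorm z ^+ j.-1) ^+ 2.
  rewrite big_add1 big_mkord; apply: eq_bigr => i _ /=.
  by rewrite -!exprM mulnC.
rewrite mulrC; apply: le_trans (sum_cauchy_schwarz _ _ _ _ _).
rewrite ler_sqr ?nnegrE ?qnorm_ge0 //; last first.
  by apply: sumr_ge0 => j _; rewrite mulr_ge0 ?exprn_ge0 ?qnorm_ge0.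
apply: le_trans (qnorm_sum _ _ _ _) _.
by apply: ler_sum => j _; rewrite qnormM qnormX.
Qed.
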